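(* Let $n\in\mathbb{N}$. Then $$\sum_{i=0}^n \sum_{j=0}^n p_{n,i}(x)\,p_{n,j}(y)\, f\left(\frac{i+j}{2n}\right)\leq (B_{2n}f)\left(\frac{x+y}{2}\right)$$ for all convex functions $f\in\mathcal{C}([0,1])$ and all $x,y\in[0,1]$.
   Context: $\mathbb{N}$ denotes the positive integers, and $\mathcal{C}([0,1])$ the continuous real-valued functions on $[0,1]$. For $n\in\mathbb{N}$, the Bernstein basic polynomials are $p_{n,i}(x)=\binom{n}{i}x^i(1-x)^{n-i}$ for $i=0,1,\dots,n$, $x\in[0,1]$ (with $0^0=1$). The Bernstein operator $B_n:\mathcal{C}([0,1])\to\mathcal{C}([0,1])$ is $(B_nf)(x)=\sum_{i=0}^n p_{n,i}(x)f\left(\frac in\right)$ for $x\in[0,1]$. *)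

(* Defs.v *)
From HB Require Import structures.
From mathcomp Require Import all_boot all_order all_algebra.
From mathcomp Require Import all_classical all_reals all_analysis.

Set Implicit Arguments.
Unset Strict Implicit.
Unset Printing Implicit Defensive.

Import Order.TTheory GRing.Theory Num.Theory.
Import numFieldNormedType.Exports.

Local Open Scope classical_set_scope.
Local Open Scope ring_scope.

(* Functions on [0, 1] are represented by total functions on R whose values
   outside [0, 1] are irrelevant. *)

(* [x ^+ 0 = 1] for every x, so the convention 0^0 = 1 holds. *)
Definition bernstein_basis (R : realType) (n i : nat) (x : R) : R :=
  'C(n, i)%:R * x ^+ i * (1 - x) ^+ (n - i).

Definition bernstein_op (R : realType) (n : nat) (f : R -> R) (x : R) : R :=
  \sum_(i < n.+1) bernstein_basis n i x * f (i%:R / n%:R).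

(* Main.v *)
(** Independent Bernoulli trials are encoded by generating polynomials: a trial
    with parameter [x] is [1 - x + x T], so both sides are values of the linear
    functional [L : T^k |-> f(k/2n)], at [A^n] and at [B^n] respectively, where
    [A = (1 - x + x T)(1 - y + y T)] and [B = (1 - m + m T)^2] with
    [m = (x + y)/2].  Since [B - A = ((x - y)/2)^2 (T - 1)^2], the difference
    [B^n - A^n] is [(T - 1)^2] times a polynomial of degree at most [2n - 2] with
    nonnegative coefficients, and [L(T^k (T - 1)^2)] is a second difference of
    the convex function [f]. *)
Require Import Defs.
From HB Require Import structures.
From mathcomp Require Import all_boot all_order all_algebra.
From mathcomp Require Import all_classical all_reals all_analysis.
From mathcomp Require Import zify ring lra.

Set Implicit Arguments.
Unset Strict Implicit.
Unset Printing Implicit Defensive.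

Import Order.TTheory GRing.Theory Num.Theory.
Import numFieldNormedType.Exports.

Local Open Scope classical_set_scope.
Local Open Scope ring_scope.

(** The codomain [R^o] is the ring as a module over itself, so that the pairing can be declared a
    linear form. *)
Definition coef_pairing (R : comNzRingType) (N : nat) (g : nat -> R)
    (p : {poly R}) : R^o :=
  \sum_(k < N) p`_k * g k.

Lemma coef_pairing_is_linear (R : comNzRingType) (N : nat) (g : nat -> R) :
  linear (coef_pairing N g).
Proof.
move=> a p q; rewrite /coef_pairing scaler_sumr -big_split /=.
by apply: eq_bigr => k _; rewrite coefD coefZ mulrDl -mulrA.
Qed.

HB.instance Definition _ (R : comNzRingType) (N : nat) (g : nat -> R) :=
  GRing.isLinear.Build R {poly R} R^o *:%R (coef_pairing N g)
    (coef_pairing_is_linear N g).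

Lemma coef_pairingXn (R : comNzRingType) (N : nat) (g : nat -> R) (k : nat) :
  (k < N)%N -> coef_pairing N g 'X^k = g k.
Proof.
move=> kN; rewrite /coef_pairing (bigD1 (Ordinal kN)) //= coefXn eqxx mul1r.
rewrite big1 ?addr0// => i; rewrite -val_eqE /= => /negPf ik.
by rewrite coefXn ik mul0r.
Qed.

(** Expanding [q] in monomials leaves nonnegative multiples of second differences of [g]. The size
    bound keeps every exponent [k.+2] below [N], so the truncated pairing drops no term. *)
Lemma coef_pairing_second_diff_ge0 (R : realDomainType) (N : nat)
    (g : nat -> R) (q : {poly R}) :
  (forall k, (k.+2 < N)%N -> 0 <= g k.+2 - g k.+1 *+ 2 + g k) ->
  q \is a polyOver (@Num.Def.nneg_num_pred R) -> ((size q).+1 < N)%N ->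
  0 <= coef_pairing N g (q * ('X - 1) ^+ 2).
Proof.
move=> g_convex /polyOverP q_ge0 sq.
rewrite -[q]coefK poly_def mulr_suml linear_sum /=; apply: sumr_ge0 => k _.
rewrite -scalerAl linearZ /=; apply: mulr_ge0; first exact: q_ge0.
have kN : (k.+2 < N)%N by apply: leq_ltn_trans sq; rewrite ltnS.
rewrite (_ : _ * _ = 'X^(k.+2) - 'X^(k.+1) *+ 2 + 'X^k); last first.
  by rewrite !exprS; ring.
rewrite linearD linearB linearMn /= !coef_pairingXn ?g_convex//.
  exact: ltnW (ltnW kN).
exact: ltnW.
Qed.

Definition bernoulli_poly (R : nzRingType) (x : R) : {poly R} :=
  (1 - x)%:P + x *: 'X.

Lemma size_bernoulli_poly (R : nzRingType) (x : R) :
  (size (bernoulli_poly x) <= 2)%N.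
Proof.
apply: leq_trans (size_polyD _ _) _; rewrite geq_max.
rewrite (leq_trans (size_polyC_leq1 _))//=.
by rewrite (leq_trans (size_scale_leq _ _))// size_polyX.
Qed.

Lemma bernoulli_poly_ge0 (R : realDomainType) (x : R) :
  0 <= x <= 1 -> bernoulli_poly x \is a polyOver (@Num.Def.nneg_num_pred R).
Proof.
move=> /andP[x0 x1]; rewrite /bernoulli_poly rpredD ?polyOverC ?polyOverZ //=.
  by rewrite -topredE /= subr_ge0.
exact: polyOverX.
Qed.

Lemma bernoulli_poly_exp (R : realType) (n : nat) (x : R) :
  bernoulli_poly x ^+ n = \sum_(i < n.+1) bernstein_basis n i x *: 'X^i.
Proof.
rewrite exprDn; apply: eq_bigr => i _; rewrite /bernstein_basis.
rewrite exprZn -polyC_exp mul_polyC scalerA -scaler_nat scalerA.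
by congr (_ *: _); ring.
Qed.

(** Each factor is 1 + x (T - 1). With x = m + d and y = m - d, the product is (u + v)(u - v) = u^2
    - v^2 for u = 1 + m (T - 1) and v = d (T - 1). *)
Lemma bernoulli_poly_mid (R : numFieldType) (x y : R) :
  bernoulli_poly ((x + y) / 2) ^+ 2 - bernoulli_poly x * bernoulli_poly y =
  ((x - y) / 2) ^+ 2 *: ('X - 1) ^+ 2.
Proof.
set m := (x + y) / 2; set d := (x - y) / 2.
have -> : x = m + d by rewrite /m /d; field.
have -> : y = m - d by rewrite /m /d; field.
rewrite /bernoulli_poly -!mul_polyC !polyCB !polyCD polyC_exp; ring.
Qed.

(** The node (k+1)/N is the midpoint of its two neighbours, so this is convexity with weight 1/2. *)
Lemma convex_function_second_diff (R : realType) (f : R -> R) (N k : nat) :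
  convex_function (`[0, 1] : set R^o) f -> (k.+2 <= N)%N ->
  0 <= f (k.+2%:R / N%:R) - f (k.+1%:R / N%:R) *+ 2 + f (k%:R / N%:R).
Proof.
move=> f_convex kN.
have N0 : (0 : R) < N%:R by rewrite ltr0n; case: N kN.
have in01 j : (j <= N)%N -> (j%:R / N%:R : R) \in (`[0, 1]%classic : set R).
  move=> jN; rewrite inE /= in_itv /= divr_ge0// ler_pdivrMr// mul1r.
  by rewrite ler_nat.
have h0 : 0 <= 2^-1 :> R by lra.
have h1 : 2^-1 <= 1 :> R by lra.
(* Convexity with its convex combinations unfolded to real arithmetic, which holds by conversion. *)
have : f (2^-1 * (k.+2%:R / N%:R) + (1 - 2^-1) * (k%:R / N%:R)) <=
    2^-1 * f (k.+2%:R / N%:R) + (1 - 2^-1) * f (k%:R / N%:R).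
  exact: (f_convex (Itv01 h0 h1) _ _ (in01 _ kN) (in01 k (ltnW (ltnW kN)))).
rewrite (_ : 2^-1 * (_ / _) + _ = k.+1%:R / N%:R); last first.
  by rewrite -(natr1 k.+1) -(natr1 k); field; rewrite gt_eqF.
lra.
Qed.

Theorem theorem2p1 (R : realType) (n : nat) (hn : (0 < n)%N)
    (f : R -> R)
    (f_cont : {within `[0, 1], continuous f})
    (f_convex : convex_function (`[0, 1] : set R^o) f)
    (x y : R) (hx : x \in `[0, 1]) (hy : y \in `[0, 1]) :
  \sum_(i < n.+1) \sum_(j < n.+1)
     bernstein_basis n i x * bernstein_basis n j y
       * f ((i + j)%:R / (2 * n)%:R)
  <= bernstein_op (2 * n) f ((x + y) / 2).
Proof.
have x01 : 0 <= x <= 1 by move: hx; rewrite in_itv.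
have y01 : 0 <= y <= 1 by move: hy; rewrite in_itv.
set m := (x + y) / 2.
have m01 : 0 <= m <= 1 by rewrite /m; lra.
pose g k := f (k%:R / (2 * n)%:R).
pose L := coef_pairing (2 * n).+1 g.
pose A := bernoulli_poly x * bernoulli_poly y; pose B := bernoulli_poly m ^+ 2.
(* Multiplying the expansions of the two n-th powers pairs T^i with T^j; the exponent i + j is at
   most 2n, inside the range of [L]. *)
have LA : \sum_(i < n.+1) \sum_(j < n.+1)
     bernstein_basis n i x * bernstein_basis n j y * g (i + j)%N = L (A ^+ n).
  rewrite /L exprMn !bernoulli_poly_exp mulr_suml linear_sum /=.
  apply: eq_bigr => i _; rewrite mulr_sumr linear_sum /=.
  apply: eq_bigr => j _.
  rewrite -[X in coef_pairing _ _ X]scalerAr -[X in _ *: X]scalerAl.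
  rewrite scalerA -exprD linearZ /= [X in X *: _]mulrC.
  rewrite coef_pairingXn//.
  by rewrite ltnS mul2n -addnn leq_add// -ltnS.
have LB : bernstein_op (2 * n) f m = L (B ^+ n).
  rewrite /L -exprM bernoulli_poly_exp linear_sum /=.
  by apply: eq_bigr => i _; rewrite linearZ /= coef_pairingXn.
(* B^n - A^n is B - A times the sum of the B^(n-1-i) A^i, and B - A is a square constant times (T -
   1)^2. *)
rewrite LA LB -subr_ge0 -linearB /= subrXX bernoulli_poly_mid.
rewrite -scalerAl linearZ /= mulr_ge0 ?sqr_ge0//.
rewrite [X in coef_pairing _ _ X]mulrC.
apply: coef_pairing_second_diff_ge0 => [k kN||].
- exact: convex_function_second_diff.
- have A_ge0 : A \is a polyOver (@Num.Def.nneg_num_pred R)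
    by rewrite rpredM ?bernoulli_poly_ge0.
  have B_ge0 : B \is a polyOver (@Num.Def.nneg_num_pred R)
    by rewrite rpredX ?bernoulli_poly_ge0.
  by apply: rpred_sum => i _; apply: rpredM; apply: rpredX.
- have sA : (size A <= 3)%N.
    apply: leq_trans (size_polyMleq _ _) _.
    by have := size_bernoulli_poly x; have := size_bernoulli_poly y; lia.
  have sB : (size B <= 3)%N.
    apply: leq_trans (size_polyMleq _ _) _.
    by have := size_bernoulli_poly m; lia.
  have sX (p : {poly R}) k : (size p <= 3)%N -> (size (p ^+ k) <= (2 * k).+1)%N.
    by move=> sp; apply: leq_trans (size_poly_exp_leq _ _) _; nia.
  (* Each summand has degree at most 2(n-1-i) + 2i = 2n - 2, leaving exactly the room needed for (T
     - 1)^2; the strict bound uses n > 0. *)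
  rewrite ltnS (@leq_ltn_trans (2 * n.-1).+1)//; last by lia.
  apply: leq_trans (size_sum _ _ _) _; apply/bigmax_leqP => i _.
  apply: leq_trans (size_polyMleq _ _) _.
  have := leq_add (sX _ (n.-1 - i)%N sB) (sX _ i sA).
  by have := ltn_ord i; set s := (size _ + size _)%N; lia.
Qed.
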